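(* Let $\lambda,\mu\in\mathbb{R}$, and let $\omega$ be the EPR state of $\mathfrak{A}=\mathfrak{A}[\mathbb{R}^{2}]\otimes\mathfrak{A}[\mathbb{R}^{2}]$ with parameters $\lambda,\mu$. Then $\omega$ is maximally Bell correlated across the pair $\mathfrak{A}_{1}=\mathfrak{A}[\mathbb{R}^{2}]\otimes I$, $\mathfrak{A}_{2}=I\otimes\mathfrak{A}[\mathbb{R}^{2}]$; that is, $$\beta(\omega,\mathfrak{A}_{1},\mathfrak{A}_{2})=\sqrt{2}.$$
   Context: The Weyl algebra $\mathfrak{A}[\mathbb{R}^{2}]$ is the $C^{*}$-algebra generated by unitary operators $W(\mathbf{a})$, $\mathbf{a}\in\mathbb{R}^{2}$, satisfying the Weyl relations $W(\mathbf{a})W(\mathbf{b})=\exp\{i\sigma(\mathbf{a},\mathbf{b})\}\,W(\mathbf{a}+\mathbf{b})$, where $\sigma((a,b),(a',b'))=\tfrac12(ab'-ba')$. (This $C^{*}$-algebra is simple, and it is determined up to isomorphism by these relations.) The tensor product $\otimes$ of $C^{*}$-algebras is the spatial (minimal) one. A state of a $C^{*}$-algebra is a positive, normalized linear functional. The EPR state with parameters $\lambda,\mu\in\mathbb{R}$ is the unique state $\omega$ of $\mathfrak{A}[\mathbb{R}^{2}]\otimes\mathfrak{A}[\mathbb{R}^{2}]$ such that $\omega(W(a,0)\otimes W(-a,0))=e^{ia\lambda}$ and $\omega(W(0,b)\otimes W(0,b))=e^{ib\mu}$ for all $a,b\in\mathbb{R}$. On Weyl operators it is given by $\omega(W(a,b)\otimes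 W(c,d))=e^{ia\lambda}e^{ib\mu}$ if $c=-a$ and $d=b$, and $0$ otherwise. For mutually commuting subalgebras $\mathfrak{A}_{1},\mathfrak{A}_{2}$ of a $C^{*}$-algebra $\mathfrak{A}$, the set of Bell operators $\mathcal{T}(\mathfrak{A}_{1},\mathfrak{A}_{2})$ is the set of all $\tfrac12[A_{1}(B_{1}+B_{2})+A_{2}(B_{1}-B_{2})]$ with $A_{i}=A_{i}^{*}\in\mathfrak{A}_{1}$, $B_{i}=B_{i}^{*}\in\mathfrak{A}_{2}$, $\|A_{i}\|\le 1$, $\|B_{i}\|\le 1$ ($i=1,2$). For a state $\omega$ of $\mathfrak{A}$, the maximal Bell correlation is $\beta(\omega,\mathfrak{A}_{1},\mathfrak{A}_{2})=\sup\{\omega(R):R\in\mathcal{T}(\mathfrak{A}_{1},\mathfrak{A}_{2})\}$. The state $\omega$ is maximally Bell correlated across $\mathfrak{A}_{1},\mathfrak{A}_{2}$ if $\beta(\omega,\mathfrak{A}_{1},\mathfrak{A}_{2})=\sqrt{2}$. *)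

(* Defs.v *)
From HB Require Import structures.
From mathcomp Require Import all_boot all_order all_algebra complex.
From mathcomp Require Import all_classical all_reals all_analysis.

Set Implicit Arguments.
Unset Strict Implicit.
Unset Printing Implicit Defensive.

Import Order.TTheory GRing.Theory Num.Theory.
Import numFieldNormedType.Exports.

Local Open Scope classical_set_scope.
Local Open Scope ring_scope.
Local Open Scope complex_scope.

(* Unital (and nontrivial, as [algType] is) C*-algebras.  The norm is a
   separate real-valued operation: the MathComp hierarchy has no join of rings
   and normed modules below [numDomainType], so that [algType R[i]] and
   [completeNormedModType R[i]] cannot be inherited together. *)
HB.mixin Record isCStarAlgebra (R : realType) A & GRing.Algebra R[i] A := {
  star : A -> A ;
  cnorm : A -> R ;
  starD : forall x y : A, star (x + y) = star x + star y ;
  starZ : forall (k : R[i]) (x : A), star (k *: x) = k^* *: star x ;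
  starM : forall x y : A, star (x * y) = star y * star x ;
  starK : forall x : A, star (star x) = x ;
  cnormD : forall x y : A, cnorm (x + y) <= cnorm x + cnorm y ;
  cnormZ : forall (k : R[i]) (x : A),
    (cnorm (k *: x))%:C = `|k| * (cnorm x)%:C ;
  cnorm_eq0 : forall x : A, cnorm x = 0 -> x = 0 ;
  cnormM : forall x y : A, cnorm (x * y) <= cnorm x * cnorm y ;
  cnorm_star : forall x : A, cnorm (star x * x) = cnorm x ^+ 2 ;
  cnorm_complete : forall u : nat -> A,
    (forall e : R, 0 < e -> exists N : nat, forall m n : nat,
       (N <= m)%N -> (N <= n)%N -> cnorm (u m - u n) < e) ->
    exists l : A, (fun n => cnorm (u n - l)) @ \oo --> (0 : R)
}.

#[short(type="cstarAlgType")]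
HB.structure Definition CStarAlgebra (R : realType) :=
  {A of isCStarAlgebra R A & GRing.Algebra R[i] A}.

(* Complex Hilbert spaces; the inner product is linear on the left. *)
HB.mixin Record isHilbert (R : realType) H & CompleteNormedModule R[i] H := {
  inner : H -> H -> R[i] ;
  innerDl : forall x y z : H, inner (x + y) z = inner x z + inner y z ;
  innerZl : forall (k : R[i]) (x y : H), inner (k *: x) y = k * inner x y ;
  innerC : forall x y : H, inner y x = (inner x y)^* ;
  inner_norm : forall x : H, inner x x = `|x| ^+ 2
}.

#[short(type="hilbertType")]
HB.structure Definition Hilbert (R : realType) :=
  {H of isHilbert R H & CompleteNormedModule R[i] H}.

Section CStar.
Context {R : realType}.
Implicit Types A B T : cstarAlgType R.

Definition closed_star_subalgebra A (S : set A) : Prop :=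
  [/\ S 1,
      forall (k : R[i]) (x y : A), S x -> S y -> S (k *: x + y),
      forall x y : A, S x -> S y -> S (x * y),
      forall x : A, S x -> S (star x)
    & forall (u : nat -> A) (l : A), (forall n, S (u n)) ->
        (fun n => cnorm (u n - l)) @ \oo --> (0 : R) -> S l].

Definition generates A (G : set A) : Prop :=
  forall S : set A, closed_star_subalgebra S -> G `<=` S -> S = setT.

Definition unitary A (u : A) : Prop := star u * u = 1 /\ u * star u = 1.

Definition is_state A (omega : {scalar A}) : Prop :=
  (forall x : A, 0 <= omega (star x * x)) /\ omega 1 = 1.

Record star_rep A (H : hilbertType R) (pi : A -> {linear H -> H}) : Prop := {
  rep_bounded : forall a, exists c : R, forall v, `|pi a v| <= c%:C * `|v| ;
  rep_linear : forall (k : R[i]) (a b : A) (v : H),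
    pi (k *: a + b) v = k *: pi a v + pi b v ;
  rep1 : forall v, pi 1 v = v ;
  repM : forall (a b : A) (v : H), pi (a * b) v = pi a (pi b v) ;
  rep_star : forall (a : A) (v w : H),
    inner (pi a v) w = inner v (pi (star a) w)
}.

Definition faithful A (H : hilbertType R) (pi : A -> {linear H -> H}) : Prop :=
  forall a, (forall v, pi a v = 0) -> a = 0.

Definition opnorm (H : hilbertType R) (f : H -> H) : R :=
  inf [set c : R | 0 <= c /\ forall v, `|f v| <= c%:C * `|v|].

(* K, with x (x) y given by t x y, is the Hilbert space tensor product of
   H1 and H2. *)
Definition hilbert_tensor (H1 H2 K : hilbertType R)
    (t : {bilinear H1 -> H2 -> K}) : Prop :=
  (forall x x' y y', inner (t x y) (t x' y') = inner x x' * inner y y') /\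
  closure [set z : K | exists n (x : 'I_n -> H1) (y : 'I_n -> H2),
             z = \sum_(i < n) t (x i) (y i)] = setT.

(* T, with a (x) b given by tens a b, is the spatial tensor product of A and
   B: for some faithful representations of A on H1 and of B on H2, T is (via
   pi) the C*-algebra of operators on the Hilbert space tensor product K
   generated by the operators pi1 a (x) pi2 b, with the operator norm.  The
   result does not depend on the choice of the faithful representations.
   Bilinearity and multiplicativity of tens follow from the formula for
   pi (tens a b). *)
Definition spatial_tensor A B T (tens : A -> B -> T) : Prop :=
  generates [set tens a b | a in setT & b in setT] /\
  exists (H1 H2 K : hilbertType R) (t : {bilinear H1 -> H2 -> K})
    (pi1 : A -> {linear H1 -> H1}) (pi2 : B -> {linear H2 -> H2})
    (pi : T -> {linear K -> K}),
    [/\ hilbert_tensor t,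
        star_rep pi1 /\ faithful pi1,
        star_rep pi2 /\ faithful pi2,
        star_rep pi /\ (forall x, cnorm x = opnorm (pi x))
      & forall a b x y, pi (tens a b) (t x y) = t (pi1 a x) (pi2 b y)].

Definition expi (r : R) : R[i] := cos r +i* sin r.

Definition sigma (z w : R * R) : R := 2^-1 * (z.1 * w.2 - z.2 * w.1).

Definition weyl_algebra A (W : R * R -> A) : Prop :=
  [/\ forall z, unitary (W z),
      forall z w, W z * W w = expi (sigma z w) *: W (z + w)
    & generates (range W)].

Definition EPR_state A T (W : R * R -> A) (tens : A -> A -> T)
    (lam mu : R) (omega : {scalar T}) : Prop :=
  [/\ is_state omega,
      forall a : R, omega (tens (W (a, 0)) (W (- a, 0))) = expi (a * lam)
    & forall b : R, omega (tens (W (0, b)) (W (0, b))) = expi (b * mu)].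

Definition sa_contraction A (S : set A) (a : A) : Prop :=
  [/\ S a, star a = a & cnorm a <= 1].

Definition bell_operators T (S1 S2 : set T) : set T :=
  [set x | exists a1 a2 b1 b2,
     [/\ sa_contraction S1 a1 /\ sa_contraction S1 a2,
         sa_contraction S2 b1 /\ sa_contraction S2 b2
       & x = (2^-1 : R[i]) *: (a1 * (b1 + b2) + a2 * (b1 - b2))]].

(* For commuting S1, S2 the Bell operators are self-adjoint, so that a state
   is real on them. *)
Definition bell_correlation T (omega : {scalar T}) (S1 S2 : set T) : R :=
  sup [set complex.Re (omega x) | x in bell_operators S1 S2].

Definition maximally_bell_correlated T (omega : {scalar T}) (S1 S2 : set T) :
    Prop :=
  bell_correlation omega S1 S2 = Num.sqrt 2.

End CStar.

(* Main.v *)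
Require Import Defs.
From mathcomp Require Import all_boot all_order all_algebra complex.
From mathcomp Require Import all_classical all_reals all_analysis.
From mathcomp Require Import ring lra.

Set Implicit Arguments.
Unset Strict Implicit.
Unset Printing Implicit Defensive.

Import Order.TTheory GRing.Theory Num.Theory.
Import numFieldNormedType.Exports.
Local Open Scope classical_set_scope.
Local Open Scope ring_scope.

(* The upper bound is Tsirelson's: the state is positive on the squares of
   sqrt 2 A_1 - (B_1 + B_2) and sqrt 2 A_2 - (B_1 - B_2), and it is at most 1 on
   the square of a self-adjoint contraction x, as 1 - r x^2 has a self-adjoint
   square root for r < 1.

   For the lower bound, u = W(1,0) and v = W(0,pi) anticommute, and so do odd
   functions h of (u + u^* )/2 and g of (v + v^* )/2.  The eigenvalue equations of
   the EPR state give mirror images u', v' in the second factor which agree with u, v on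
   the state vector, whence omega(h h') = omega(h^2).  With
   B_1, B_2 = (h' +- g')/sqrt 2, which are contractions by anticommutation, the
   Bell correlation is (omega(h^2) + omega(g^2))/sqrt 2.

   To approximate a sign function by polynomials, the odd map
   t -> t (3 - t^2)/2 is iterated: it sends [-1,1] to itself and pushes every
   t <> 0 towards 1 or -1.  The defect q = 1 - h^2 concentrates on the kernel of
   u + u^*, where -u^2 acts as 1; but omega vanishes on the nontrivial
   powers of u, so the averages of the powers of -u^2 tend to 0 on the state
   vector, and omega(q) tends to 0. *)

(** * Sums of squares in a star algebra, and the Newton iteration for the sign function *)

Section StarAlgebra.
Context {R : realType} {A : cstarAlgType R}.
Implicit Types (x y z h s u v : A) (k : R[i]) (r : R).

Lemma star0 : star (0 : A) = 0.
Proof. by apply: (addrI (star 0)); rewrite -starD !addr0. Qed.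

Lemma starN x : star (- x) = - star x.
Proof. by apply/eqP; rewrite -subr_eq0 opprK -starD addNr star0. Qed.

Lemma starB x y : star (x - y) = star x - star y.
Proof. by rewrite starD starN. Qed.

Lemma star1 : star (1 : A) = 1.
Proof. by rewrite -[LHS]mul1r -{1}(starK 1) -starM mul1r starK. Qed.

Lemma starMn x n : star (x *+ n) = star x *+ n.
Proof. by elim: n => [|n IH]; rewrite ?mulr0n ?star0// !mulrS starD IH. Qed.

Lemma conjC_real r : ((r%:C)%C)^* = (r%:C)%C.
Proof. exact: conjc_real. Qed.

Lemma starZr r x : star ((r%:C)%C *: x) = (r%:C)%C *: star x.
Proof. by rewrite starZ conjC_real. Qed.

Lemma star_nat n : star (n%:R : A) = n%:R.
Proof. by rewrite starMn star1. Qed.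

(* The algebraic positive cone: in the state and in every representation its
   elements are positive, without any appeal to spectral theory. *)
Definition sos x := exists ys : seq A, x = \sum_(y <- ys) star y * y.

Lemma sos0 : sos 0. Proof. by exists [::]; rewrite big_nil. Qed.

Lemma sos_square x : sos (star x * x).
Proof. by exists [:: x]; rewrite big_seq1. Qed.

Lemma sosD x y : sos x -> sos y -> sos (x + y).
Proof. by move=> [xs ->] [ys ->]; exists (xs ++ ys); rewrite big_cat. Qed.

Lemma sosJ s x : sos x -> sos (star s * x * s).
Proof.
move=> [xs ->]; exists [seq y * s | y <- xs].
rewrite big_map mulr_sumr mulr_suml; apply: eq_bigr => y _.
by rewrite starM !mulrA.
Qed.

Lemma sosZ r x : 0 <= r -> sos x -> sos ((r%:C)%C *: x).
Proof.
move=> r0 /(sosJ (((Num.sqrt r)%:C)%C *: 1)); rewrite starZr star1.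
by rewrite -scalerAl mul1r -scalerAr mulr1 scalerA -rmorphM -expr2 sqr_sqrtr.
Qed.

Lemma sos_sqr x : star x = x -> sos (x * x).
Proof. by move=> {1}<-; exact: sos_square. Qed.

Lemma sos_conj s x : star s = s -> sos x -> sos (s * x * s).
Proof. by move=> {1}<-; exact: sosJ. Qed.

Lemma sosMn x n : sos x -> sos (x *+ n).
Proof.
by move=> px; elim: n => [|n IH]; rewrite ?mulr0n ?mulrS; [exact: sos0|exact: sosD].
Qed.

Lemma scaleC x r1 r2 : (r1%:C)%C *: ((r2%:C)%C *: x) = ((r1 * r2)%:C)%C *: x.
Proof. by rewrite scalerA rmorphM. Qed.

Lemma scale1C x : (1%:C)%C *: x = x.
Proof. by rewrite rmorph1 scale1r. Qed.

Lemma scaleC_nat n x : (n%:R%:C)%C *: x = x *+ n.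
Proof. by rewrite rmorph_nat scaler_nat. Qed.

Lemma scale_quarter x : ((4^-1)%:C)%C *: (x *+ 4) = x.
Proof. by rewrite -scaleC_nat scaleC mulVf ?pnatr_eq0// scale1C. Qed.

(** This is the Newton-Schulz step for the sign function. It is free of division, so all iterates
    are odd polynomials in [h]. *)
Definition newton h := ((2^-1)%:C)%C *: (h * (3 - h * h)).

Lemma star_newton h : star h = h -> star (newton h) = newton h.
Proof.
move=> hh; rewrite /newton starZr starM starB starM star_nat hh.
by congr (_ *: _); rewrite mulrBl mulrBr !mulrA mulr_natl mulr_natr.
Qed.

(** The defect is squared up to a bounded factor. The form [q * (3 + q) * q] displays it as a
    conjugate of a positive element, so that [sos_conj] applies. *)
Lemma newton_defect h :
  let q := 1 - h * h in
  1 - newton h * newton h = ((4^-1)%:C)%C *: (q * (3 + q) * q).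
Proof.
move=> q.
rewrite /newton -scalerAl -scalerAr scaleC -invfM -natrM.
rewrite -[X in X - _](scale_quarter 1) -scalerBr; congr (_ *: _).
(* Only [h] occurs in the identity, so it can be checked by [ring] in the commutative algebra of
   polynomials and then evaluated at [h]. *)
have /(congr1 (horner_alg h)) : 4 - 'X * (3 - 'X * 'X) * ('X * (3 - 'X * 'X))
    = (1 - 'X * 'X) * (3 + (1 - 'X * 'X)) * (1 - 'X * 'X) :> {poly R[i]} by ring.
by rewrite !(rmorphB, rmorphD, rmorphM, rmorph_nat, rmorph1) /= !horner_algX.
Qed.

Lemma sos_newton h : star h = h -> sos (1 - h * h) ->
  sos (1 - newton h * newton h).
Proof.
move=> hh pq; set q := 1 - h * h in pq *.
have sq : star q = q by rewrite /q starB star1 starM hh.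
rewrite newton_defect -/q; apply: sosZ; first by rewrite invr_ge0.
apply: sos_conj => //; apply: sosD => //.
by apply: sosMn; rewrite -[1]mulr1; apply: sos_sqr; exact: star1.
Qed.

Lemma newton_gainE h :
  let q := 1 - h * h in
  newton h * newton h - h * h = ((4^-1)%:C)%C *: (h * (q *+ 4 + q * q) * h).
Proof.
move=> q.
rewrite /newton -scalerAl -scalerAr scaleC -invfM -natrM.
rewrite -[X in _ - X](scale_quarter (h * h)) -scalerBr; congr (_ *: _).
have /(congr1 (horner_alg h)) : let q := 1 - 'X * 'X in
    'X * (3 - 'X * 'X) * ('X * (3 - 'X * 'X)) - ('X * 'X) *+ 4
    = 'X * (q *+ 4 + q * q) * 'X :> {poly R[i]} by move=> /=; ring.
by rewrite /= !(rmorphB, rmorphD, rmorphM, rmorph_nat, rmorph1, rmorphMn) /=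
  !horner_algX.
Qed.

Lemma sos_newton_gain h : star h = h -> sos (1 - h * h) ->
  sos (newton h * newton h - h * h).
Proof.
move=> hh pq; rewrite newton_gainE; apply: sosZ; first by rewrite invr_ge0.
apply: sos_conj => //; apply: sosD; first exact: sosMn.
by apply: sos_sqr; rewrite starB star1 starM hh.
Qed.

(** This bounds the growth of h^2 in one step from below by q h^2 q with q = 1 - h^2. The bound is
    summed over the iteration in [newton_escapes]. *)
Lemma sos_newton_gain_defect h : star h = h -> sos (1 - h * h) ->
  sos (newton h * newton h - h * h - (1 - h * h) * (h * h) * (1 - h * h)).
Proof.
move=> hh pq; rewrite newton_gainE /=.
rewrite -[X in _ - X]scale_quarter -scalerBr; apply: sosZ; first by rewrite invr_ge0.
set q := 1 - h * h in pq *.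
(* Since q = 1 - h^2, one has 4 q - 3 q^2 = q (1 + 3 h^2), and both resulting terms are conjugates
   of q. *)
have -> : h * (q *+ 4 + q * q) * h - q * (h * h) * q *+ 4 =
    h * q * h + (h * h) * (q *+ 3) * (h * h).
  rewrite /q.
  have /(congr1 (horner_alg h)) : let q := 1 - 'X * 'X in
      'X * (q *+ 4 + q * q) * 'X - q * ('X * 'X) * q *+ 4 =
      'X * q * 'X + ('X * 'X) * (q *+ 3) * ('X * 'X) :> {poly R[i]} by move=> /=; ring.
  by rewrite /= !(rmorphB, rmorphD, rmorphM, rmorph1, rmorphMn) /= !horner_algX.
apply: sosD; first exact: sos_conj.
by apply: sos_conj; [rewrite starM hh|exact: sosMn].
Qed.

End StarAlgebra.

(** * States: Cauchy-Schwarz, null vectors, eigenvectors, and growth along the iteration *)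

Section State.
Context {R : realType} {A : cstarAlgType R} (omega : {scalar A}).
Hypothesis state_omega : is_state omega.
Implicit Types (x y z h s u v w : A) (k : R[i]) (r : R).

Definition re_state x : R := complex.Re (omega x).
Local Notation rho := re_state.

Lemma re_stateD x y : rho (x + y) = rho x + rho y.
Proof. by rewrite /re_state linearD; case: (omega x) (omega y) => [? ?] []. Qed.

Lemma re_stateN x : rho (- x) = - rho x.
Proof. by rewrite /re_state linearN; case: (omega x). Qed.

Lemma re_stateB x y : rho (x - y) = rho x - rho y.
Proof. by rewrite re_stateD re_stateN. Qed.

Lemma stateZ k x : omega (k *: x) = k * omega x.
Proof. by rewrite linearZ. Qed.

Lemma re_stateZ r x : rho ((r%:C)%C *: x) = r * rho x.
Proof. by rewrite /re_state stateZ; case: (omega x) => a b /=; rewrite mul0r subr0. Qed.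

Lemma re_state1 : rho 1 = 1.
Proof. by rewrite /re_state state_omega.2. Qed.

Lemma re_state_sos x : sos x -> 0 <= rho x.
Proof.
move=> [ys ->]; elim: ys => [|y ys IH].
  by rewrite big_nil /re_state linear0.
rewrite big_cons re_stateD addr_ge0// /re_state.
by have := state_omega.1 y; rewrite lecE => /andP[].
Qed.

(** Polarization: the state is real on the square of 1 + k x, and the choices k = 1 and k = i
    determine the imaginary and the real part. *)
Lemma state_star x : omega (star x) = (omega x)^*.
Proof.
have real_sq y : complex.Im (omega (star y * y)) = 0.
  exact: ger0_Im (state_omega.1 y).
have E k : complex.Im (k * omega x + k^* * omega (star x)) = 0.
  have := real_sq (1 + k *: x).
  rewrite starD star1 starZ mulrDl !mulrDr !mul1r !mulr1 -scalerAl -scalerAr.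
  rewrite !linearD /= !stateZ state_omega.2 /=.
  have := real_sq x; case: (omega (star x * x)) => a b /= ->.
  case: k => c d /=; case: (omega x) => e f; case: (omega _) => g i /=.
  lra.
move: (E 1) (E 'i); rewrite conjCi rmorph1 -complexiE.
by case: (omega x) => e f; case: (omega _) => g i /= H1 H2; congr Complex; lra.
Qed.

Lemma re_state_star x : rho (star x) = rho x.
Proof. by rewrite /re_state state_star; case: (omega x). Qed.

Lemma re_state_starM x y : rho (star y * x) = rho (star x * y).
Proof. by rewrite -re_state_star starM starK. Qed.

Lemma re_state_CauchySchwarz x y :
  rho (star x * y) ^+ 2 <= rho (star x * x) * rho (star y * y).
Proof.
set a := rho (star x * x); set b := rho (star x * y); set c := rho (star y * y).
have a0 : 0 <= a by apply: re_state_sos; exact: sos_square.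
have E (s t : R) : 0 <= s ^+ 2 * a + 2 * s * t * b + t ^+ 2 * c.
  have H := re_state_sos (sos_square ((s%:C)%C *: x + (t%:C)%C *: y)).
  rewrite starD !starZr mulrDl !mulrDr -!scalerAl -!scalerAr in H.
  by rewrite !re_stateD !re_stateZ (re_state_starM x y) -/a -/b -/c in H; lra.
have [a_eq0|a_neq0] := eqVneq a 0.
  have c0 : 0 <= c by apply: re_state_sos; exact: sos_square.
  (* With a = 0 the quadratic form takes the value - (c + 2) b^2 here, which forces b = 0. *)
  have := E (- (c + 1)) b; rewrite a_eq0 mul0r => H.
  have : 0 <= b ^+ 2 * c by rewrite mulr_ge0// sqr_ge0.
  lra.
(* The ratio -b : a minimizes the form. *)
have := E (- b) a.
have -> : (- b) ^+ 2 * a + 2 * - b * a * b + a ^+ 2 * c = a * (a * c - b ^+ 2) by ring.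
by rewrite pmulr_rge0 ?subr_ge0// lt_neqAle eq_sym a_neq0.
Qed.

Lemma re_state_CS_unitary u y r : unitary u -> 0 <= r ->
  rho (star y * y) <= r ^+ 2 -> rho (u * y) <= r.
Proof.
move=> [_ uu] r0 yr; have := re_state_CauchySchwarz (star u) y.
rewrite starK uu re_state1 mul1r; nra.
Qed.

(** In the GNS representation this says that [y] annihilates the state vector. Equalities on the
    state vector can thus be stated without constructing that representation. *)
Definition null y := forall z, omega (z * y) = 0.

Lemma nullP y : rho (star y * y) = 0 -> null y.
Proof.
move=> y0.
have E z : rho (z * y) = 0.
  have := re_state_CauchySchwarz (star z) y; rewrite y0 mulr0 starK.
  by move=> H; apply/eqP; rewrite -sqrf_eq0 eq_le H sqr_ge0.
move=> z; have := E z; have := E ('i *: z).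
rewrite /re_state -scalerAl stateZ -complexiE.
by case: (omega _) => a b /= H1 H2; congr Complex; lra.
Qed.

Lemma nullM z y : null y -> null (z * y).
Proof. by move=> ny t; rewrite mulrA ny. Qed.

Lemma nullD x y : null x -> null y -> null (x + y).
Proof. by move=> nx ny t; rewrite mulrDr linearD nx ny addr0. Qed.

Lemma nullZ k y : null y -> null (k *: y).
Proof. by move=> ny t; rewrite -scalerAr stateZ ny mulr0. Qed.

Lemma nullN y : null y -> null (- y).
Proof. by move=> ny; rewrite -scaleN1r; exact: nullZ. Qed.

(** The state vector is an eigenvector of [u]: the squared norm of its image under u - k is 1 - 2
    |k|^2 + |k|^2 = 0. *)
Lemma null_eigen u k : unitary u -> omega u = k -> k^* * k = 1 ->
  null (u - k *: 1).
Proof.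
move=> [uu _] uk kk; apply: nullP.
rewrite starB starZ star1 mulrBl !mulrBr uu -!scalerAl -!scalerAr mul1r mulr1.
rewrite scalerA kk scale1r !re_stateB mul1r /re_state !stateZ state_star uk.
by rewrite state_omega.2 (mulrC k) kk /=; lra.
Qed.

Lemma iter_newton x n : star x = x -> sos (1 - x * x) ->
  let h := iter n newton x in
  [/\ star h = h, sos (1 - h * h) & sos (h * h - x * x)].
Proof.
move=> xx px; elim: n => [|n [hh ph gh]] /=.
  by split => //; rewrite subrr; exact: sos0.
split; [exact: star_newton|exact: sos_newton|].
set h := iter n newton x in hh ph gh *.
rewrite -(subrK (h * h) (newton h * _)) -addrA; apply: sosD => //.
exact: sos_newton_gain.
Qed.

(** Otherwise the expectation of h^2 would grow by more than [e] at every step, although h^2 <= 1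
    bounds it. The growth q h^2 q dominates q x^2 q because the iteration only increases the
    square. *)
Lemma newton_escapes x e : star x = x -> sos (1 - x * x) -> 0 < e ->
  exists n, let q := 1 - iter n newton x * iter n newton x in
    rho (q * (x * x) * q) <= e.
Proof.
move=> xx px e0; apply/not_existsP => /= H.
have grow n : n%:R * e <= rho (iter n newton x * iter n newton x).
  elim: n => [|n IH].
    by rewrite mul0r; apply: re_state_sos; exact: sos_sqr.
  have [hh ph gh] := iter_newton n xx px; have := H n.
  rewrite iterS; set h := iter n newton x in hh ph gh IH *.
  have := re_state_sos (sos_newton_gain_defect hh ph).
  have : star (1 - h * h) = 1 - h * h by rewrite starB star1 starM hh.
  move: (1 - h * h) => q sq; have := re_state_sos (sos_conj sq gh).
  rewrite mulrBr mulrBl !re_stateB -[n.+1]addn1 natrD mulrDl mul1r.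
  by move=> ? ? /negP; rewrite -ltNge; lra.
have := archi_boundP (ltW (divr_gt0 ltr01 e0)).
rewrite ltr_pdivrMr// => /lt_le_trans/(_ (grow _)).
set n := Num.bound _; have [hh ph _] := iter_newton n xx px.
by have := re_state_sos ph; rewrite re_stateB re_state1; lra.
Qed.

End State.

(** * Unitaries, their real parts, and anticommutation *)

Section Unitary.
Context {R : realType} {A : cstarAlgType R}.
Implicit Types (u v w h g x : A).

Lemma unitaryX u n : unitary u -> unitary (u ^+ n).
Proof.
move=> [u1 u2]; elim: n => [|n [IH1 IH2]].
  by rewrite expr0 /unitary star1 mulr1.
split; first by rewrite exprS starM mulrA -(mulrA (star _)) u1 mulr1 IH1.
by rewrite exprSr starM mulrA -(mulrA _ u) u2 mulr1 IH2.
Qed.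

Lemma unitaryM u v : unitary u -> unitary v -> unitary (u * v).
Proof.
move=> [u1 u2] [v1 v2]; rewrite /unitary starM; split.
  by rewrite mulrA -(mulrA (star v)) u1 mulr1.
by rewrite mulrA -(mulrA u) v2 mulr1.
Qed.

Lemma unitary_star u : unitary u -> unitary (star u).
Proof. by move=> [u1 u2]; split; rewrite starK. Qed.

Lemma unitaryZ (k : R[i]%C) u : k^* * k = 1 -> unitary u -> unitary (k *: u).
Proof.
by move=> kk [u1 u2]; split;
  rewrite starZ -scalerAl -scalerAr scalerA ?u1 ?u2 ?(mulrC k) kk scale1r.
Qed.

Lemma unitaryN u : unitary u -> unitary (- u).
Proof. by move=> [u1 u2]; split; rewrite starN mulrNN. Qed.

Definition re_part x : A := ((2^-1)%:C)%C *: (x + star x).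

Lemma star_re_part x : star (re_part x) = re_part x.
Proof. by rewrite /re_part starZr starD starK addrC. Qed.

(** The algebraic form of 1 - cos^2 = sin^2, with the imaginary part of [u] in the role of the
    sine. *)
Lemma sos_re_part u : unitary u -> sos (1 - re_part u * re_part u).
Proof.
move=> [u1 u2].
have -> : 1 - re_part u * re_part u =
    ((4^-1)%:C)%C *: (star (u - star u) * (u - star u)).
  rewrite /re_part -scalerAl -scalerAr scaleC -invfM -natrM.
  rewrite -[X in X - _](scale_quarter 1) -scalerBr; congr (_ *: _).
  rewrite starB starK !mulrDl !mulrDr !mulNr !mulrN u1 u2 opprK.
  rewrite (addrC (- (u * u))) (addrACA (u * u)) (addrACA 1) -opprD.
  rewrite (addrC 1 (star u * _)) (addrACA (u * u)) (addrC (star u * _)).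
  by rewrite (mulrnDr 1 2 2) mulr2n opprD addrACA subrr addr0.
by apply: sosZ; [rewrite invr_ge0|exact: sos_square].
Qed.

Definition anticommute x y := x * y = - (y * x).

Lemma anticommuteC x y : anticommute x y -> anticommute y x.
Proof. by rewrite /anticommute => ->; rewrite opprK. Qed.

Lemma anticommuteZ (k l : R[i]%C) x y :
  anticommute x y -> anticommute (k *: x) (l *: y).
Proof.
rewrite /anticommute => xy.
by rewrite -!scalerAl -!scalerAr xy !scalerN !scalerA mulrC.
Qed.

(** The Newton step is [h] times a polynomial in h^2, and h^2 commutes with [g], so exactly one sign
    appears. *)
Lemma anticommute_newton h g : anticommute h g -> anticommute (newton h) g.
Proof.
rewrite /anticommute /newton => hg.
have comm : h * h * g = g * (h * h).
  by rewrite -mulrA hg mulrN !mulrA hg mulNr opprK.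
rewrite -scalerAl -scalerAr -scalerN; congr (_ *: _).
rewrite -mulrA mulrBl comm mulr_natl -mulr_natr -mulrBr mulrA hg mulNr.
by rewrite mulrA.
Qed.

Lemma anticommute_iter_newton h g m n :
  anticommute h g -> anticommute (iter m newton h) (iter n newton g).
Proof.
move=> hg; elim: m => [|m IH]; last exact: anticommute_newton.
elim: n => [//|n IH] /=.
exact/anticommuteC/anticommute_newton/anticommuteC.
Qed.

Lemma anticommute_starl u v : unitary u -> anticommute u v ->
  anticommute (star u) v.
Proof.
move=> [u1 u2] uv; rewrite /anticommute.
have -> : star u * v = star u * (v * u) * star u by rewrite -!mulrA u2 mulr1.
by rewrite (anticommuteC uv) mulrN mulrA u1 mul1r mulNr.
Qed.

Lemma anticommute_re_part u v : unitary u -> unitary v -> anticommute u v ->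
  anticommute (re_part u) (re_part v).
Proof.
move=> hu hv uv.
have uv' := anticommute_starl hu uv.
have vu := anticommute_starl hv (anticommuteC uv).
have vu' := anticommute_starl hv (anticommuteC uv').
apply: anticommuteZ; rewrite /anticommute mulrDl !mulrDr uv uv'.
rewrite (anticommuteC vu) (anticommuteC vu') !mulrDl !opprD.
by rewrite !addrA; congr (_ + _); rewrite addrAC.
Qed.

End Unitary.

(** * A quantitative mean ergodic estimate, and the decay of the defect *)

Section Ergodic.
Context {R : realType} {A : cstarAlgType R} (omega : {scalar A}).
Hypothesis state_omega : is_state omega.
Implicit Types (x y z q u w : A).
Local Notation rho := (re_state omega).

Section GeometricSum.
Variable w : A.
Hypotheses (unitary_w : unitary w) (rho_w : forall n, rho (w ^+ n.+1) = 0).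
Let D n := \sum_(i < n) w ^+ i.

Lemma re_state_geom_orth m n : (m <= n)%N -> rho (w ^+ n * star (D m)) = 0.
Proof.
elim: m => [|m IH] mn; first by rewrite /D big_ord0 star0 mulr0 /re_state linear0.
rewrite /D big_ord_recr /= starD mulrDr re_stateD IH ?add0r ?(ltnW mn)//.
have -> : w ^+ n = w ^+ (n - m.+1).+1 * w ^+ m by rewrite -exprD addSn -addnS subnK.
by rewrite -mulrA (unitaryX m unitary_w).2 mulr1 rho_w.
Qed.

(** Applied to the state vector, the adjoints of the powers of [w] give unit vectors, orthogonal for
    the real inner product; this is Pythagoras for n of them. *)
Lemma re_state_geom_norm n : rho (D n * star (D n)) = n%:R.
Proof.
elim: n => [|n IH]; first by rewrite /D big_ord0 mul0r /re_state linear0.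
rewrite /D big_ord_recr /= starD mulrDl !mulrDr !re_stateD IH.
rewrite (unitaryX n unitary_w).2 re_state1// re_state_geom_orth// add0r.
rewrite -(re_state_star state_omega (D n * _)) starM starK re_state_geom_orth//.
by rewrite addr0 natr1.
Qed.

(** By Cauchy-Schwarz each further factor [w] lowers the expectation of w^i q by at most [r]. The
    total loss, the sum of i r over i < n, is at most n^2 r. *)
Lemma geom_sum_lower q r : 0 <= r ->
    rho (star ((1 - w) * q) * ((1 - w) * q)) <= r ^+ 2 ->
  forall n, n%:R * rho q - (n * n)%:R * r <= rho (D n * q).
Proof.
move=> r0 qr.
have E n : rho q - n%:R * r <= rho (w ^+ n * q).
  elim: n => [|n IH]; first by rewrite expr0 mul1r mul0r subr0.
  have -> : w ^+ n.+1 * q = w ^+ n * q - w ^+ n * ((1 - w) * q).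
    by rewrite mulrBl mul1r mulrBr subKr exprSr mulrA.
  rewrite re_stateB -natr1 mulrDl mul1r opprD addrA lerB//.
  exact: (re_state_CS_unitary state_omega (unitaryX n unitary_w)).
elim=> [|n IH]; first by rewrite /D big_ord0 mul0n mulr0n !mul0r subr0 /re_state linear0.
rewrite /D big_ord_recr /= mulrDl re_stateD.
have := E n; move: IH; rewrite -/(D n) -[n.+1]addn1 !natrM !natrD.
have : 0 <= n%:R * r by rewrite mulr_ge0.
by nra.
Qed.

(** Cauchy-Schwarz bounds the sum of n^2 terms by the root of n^2, against the lower bound of
    [geom_sum_lower]. A square number of terms keeps the root equal to n. For n > 0 the outcome is
    rho q <= 1/n + n^2 r. *)
Lemma ergodic_bound q r n : 0 <= r -> rho (star q * q) <= 1 ->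
    rho (star ((1 - w) * q) * ((1 - w) * q)) <= r ^+ 2 ->
  (n ^ 2)%:R * rho q <= n%:R + (n ^ 4)%:R * r.
Proof.
move=> r0 q1 qr; have := geom_sum_lower r0 qr (n ^ 2).
rewrite -expnD => lower.
suff : rho (D (n ^ 2) * q) <= n%:R by lra.
have := re_state_CauchySchwarz state_omega (star (D (n ^ 2))) q.
rewrite starK re_state_geom_norm => CS.
have {CS} : rho (D (n ^ 2) * q) ^+ 2 <= n%:R ^+ 2.
  apply: le_trans CS _; rewrite -natrX -[leRHS]mulr1.
  by apply: ler_wpM2l.
by have := ler0n R n; nra.
Qed.

End GeometricSum.

Lemma newton_defect_small u e : unitary u ->
    (forall n, omega (u ^+ n.+1) = 0) -> 0 < e ->
  exists k, let h := iter k newton (re_part u) in rho (1 - h * h) <= e.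
Proof.
move=> hu u0 e0; set x := re_part u.
have xx : star x = x by exact: star_re_part.
have px : sos (1 - x * x) by exact: sos_re_part.
have [n n0 ne] : exists2 n, (0 < n)%N & 2 <= n%:R * e.
  exists (Num.bound (2 / e)).+1 => //.
  have := archi_boundP (ltW (divr_gt0 (ltr0Sn _ 1) e0)).
  by rewrite ltr_pdivrMr// -natr1; lra.
(* Both error terms of [ergodic_bound], 1/n and n^2 r, are now at most e/2. *)
pose r := e / (2 * (n ^ 2)%:R).
have n2 : 0 < (n ^ 2)%:R :> R by rewrite ltr0n expn_gt0 n0.
have r0 : 0 < r by rewrite divr_gt0// mulr_gt0.
have [k small] := newton_escapes state_omega xx px (divr_gt0 (exprn_gt0 2 r0) (ltr0Sn R 3)).
exists k; move: small; have [] := iter_newton k xx px.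
set h := iter k newton x => hh ph _ /=.
set q := 1 - h * h in ph * => small.
have qq : star q = q by rewrite /q starB star1 starM hh.
pose w := - (u * u).
have hw : unitary w by exact/unitaryN/unitaryM.
have w0 m : rho (w ^+ m.+1) = 0.
  (* Up to sign this is u^(2 m + 2), a nontrivial power of [u]. *)
  rewrite /w exprNn -signr_odd -expr2 -exprM mulnS.
  by case: odd; rewrite ?expr1 ?mulN1r ?mul1r ?re_stateN /re_state u0 ?oppr0.
have q1 : rho (star q * q) <= 1.
  have : sos (1 - star q * q).
    have -> : 1 - star q * q = h * h + h * q * h.
      rewrite qq; rewrite /q.
      have /(congr1 (horner_alg h)) : 1 - (1 - 'X * 'X) * (1 - 'X * 'X) =
          'X * 'X + 'X * (1 - 'X * 'X) * 'X :> {poly R[i]%C} by ring.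
      by rewrite /= !(rmorphB, rmorphD, rmorphM, rmorph1) /= !horner_algX.
    by apply: sosD; [exact: sos_sqr|exact: sos_conj].
  by move/(re_state_sos state_omega); rewrite re_stateB re_state1// subr_ge0.
have qr : rho (star ((1 - w) * q) * ((1 - w) * q)) <= r ^+ 2.
  (* Thus 1 - w is small where x is small, and the squared norm to be bounded is 4 rho (q x^2 q);
     this is why [newton_escapes] was applied with r^2 / 4. *)
  have -> : 1 - w = u * x *+ 2.
    rewrite /w /x /re_part opprK -scalerAr -scaleC_nat scaleC mulfV ?pnatr_eq0//.
    by rewrite scale1C mulrDr hu.2 addrC.
  rewrite mulrnAl starMn !starM xx qq.
  have -> : q * (x * star u) *+ 2 * (u * x * q *+ 2) = q * (x * x) * q *+ 4.
    rewrite mulrnAl mulrnAr -mulrnA; congr (_ *+ _).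
    by rewrite !mulrA -(mulrA _ (star u)) hu.1 mulr1.
  rewrite -scaleC_nat re_stateZ.
  by rewrite -ler_pdivlMl// mulrC.
have := ergodic_bound hw w0 n (ltW r0) q1 qr.
have -> : (n ^ 4)%:R * r = (n ^ 2)%:R * (e / 2) :> R.
  rewrite /r (_ : 4 = 2 + 2)%N// expnD natrM; field.
  by rewrite pnatr_eq0 -lt0n.
have : n%:R <= (n ^ 2)%:R * (e / 2).
  by rewrite natrX expr2 -mulrA ler_peMr ?ler0n//; lra.
by move=> H1 H2; rewrite -(ler_pM2l n2); lra.
Qed.

End Ergodic.

(** * The C*-norm, square roots near 1, and Tsirelson's inequality *)

Section SquareRoot.
Context {R : realType} {A : cstarAlgType R}.
Implicit Types (a x y z : A) (r : R).

Lemma cnorm0 : cnorm (0 : A) = 0.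
Proof.
have := cnormZ (0 : R[i]%C) (0 : A).
by rewrite scale0r normr0 mul0r => /complexI.
Qed.

Lemma cnormZr r x : cnorm ((r%:C)%C *: x) = `|r| * cnorm x.
Proof.
have := cnormZ ((r%:C)%C : R[i]%C) x; rewrite normc_def /= expr0n addr0 sqrtr_sqr.
by rewrite -rmorphM => /complexI.
Qed.

Lemma cnormN x : cnorm (- x) = cnorm x.
Proof.
rewrite -[LHS]mul1r -(normrN1 R) -cnormZr; congr cnorm.
by rewrite rmorphN1 scaleN1r opprK.
Qed.

Lemma cnorm_ge0 x : 0 <= cnorm x.
Proof. by have := cnormD x (- x); rewrite subrr cnorm0 cnormN; lra. Qed.

Lemma cnormB x y : cnorm (x - y) = cnorm (y - x).
Proof. by rewrite -cnormN opprB. Qed.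

Lemma cnorm_starE x : cnorm (star x) = cnorm x.
Proof.
have le y : cnorm y <= cnorm (star y).
  have := cnormM (star y) y; rewrite cnorm_star => H.
  by have := cnorm_ge0 y; have := cnorm_ge0 (star y); nra.
by apply/eqP; rewrite eq_le le -{2}(starK x) le.
Qed.

Lemma cnorm_small x : (forall e, 0 < e -> cnorm x <= e) -> x = 0.
Proof.
move=> H; apply: cnorm_eq0; apply/eqP; rewrite eq_le cnorm_ge0 andbT.
by apply/ler_addgt0Pl => e e0; rewrite addr0 H.
Qed.

(* Writing the square root as [1 - x], the equation [(1 - x)^2 = 1 - a] becomes
   the fixed point equation [x = (a + x^2) / 2], which is a contraction on the
   ball of radius [cnorm a]. *)
Lemma sqrt_one_minus a : star a = a -> cnorm a < 1 ->
  exists s, star s = s /\ s * s = 1 - a.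
Proof.
move=> aa a1; set c := cnorm a in a1 *; have c0 : 0 <= c := cnorm_ge0 a.
pose f x := ((2^-1)%:C)%C *: (a + x * x).
have fball x : cnorm x <= c -> cnorm (f x) <= c.
  move=> xc; rewrite /f cnormZr ger0_norm ?invr_ge0//.
  have := cnormD a (x * x); have := cnormM x x; have := cnorm_ge0 x.
  by rewrite -/c; nra.
have flip x y : cnorm x <= c -> cnorm y <= c ->
    cnorm (f x - f y) <= c * cnorm (x - y).
  move=> xc yc; rewrite /f -scalerBr cnormZr ger0_norm ?invr_ge0//.
  have -> : a + x * x - (a + y * y) = x * (x - y) + (x - y) * y.
    by rewrite opprD addrACA subrr add0r mulrBr mulrBl addrA subrK.
  have := cnormD (x * (x - y)) ((x - y) * y).
  have := cnormM x (x - y); have := cnormM (x - y) y.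
  by have := cnorm_ge0 (x - y); nra.
pose u n := iter n f 0.
have uball n : cnorm (u n) <= c.
  by elim: n => [|n IH]; rewrite /u /= ?cnorm0//; exact: fball.
have ustar n : star (u n) = u n.
  by elim: n => [|n IH]; rewrite /u /= ?star0// /f starZr starD starM IH aa.
have udist n m : cnorm (u (n + m)%N - u n) <= c ^+ n.
  elim: n m => [|n IH] m.
    by rewrite add0n /u /= subr0 expr0 (le_trans (uball m))// ltW.
  rewrite addSn /u !iterS exprS; apply: le_trans (flip _ _ (uball _) (uball _)) _.
  by rewrite ler_wpM2l.
have cpow : (fun n => c ^+ n) @ \oo --> (0 : R).
  by apply: cvg_expr; rewrite ger0_norm.
have ucauchy : forall e : R, 0 < e -> exists N : nat, forall m n : nat,
    (N <= m)%N -> (N <= n)%N -> cnorm (u m - u n) < e.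
  move=> e e0; have /cvgr0Pnorm_lt/(_ e e0) [N _ HN] := cpow.
  have small k : (N <= k)%N -> c ^+ k < e.
    by move=> Nk; have := HN k Nk; rewrite ger0_norm ?exprn_ge0.
  exists N => m n Nm Nn.
  case: (leqP n m) => [nm|/ltnW mn].
    by rewrite -(subnKC nm) (le_lt_trans (udist _ _))// small.
  by rewrite cnormB -(subnKC mn) (le_lt_trans (udist _ _))// small.
have [l ul] := cnorm_complete u ucauchy.
have near_l e : 0 < e -> exists n, cnorm (u n - l) < e /\ cnorm (u n.+1 - l) < e.
  move=> e0; have /cvgr0Pnorm_lt/(_ e e0) [N _ HN] := ul.
  exists N; split.
    by have := HN N (leqnn N); rewrite ger0_norm ?cnorm_ge0.
  by have := HN N.+1 (leqnSn N); rewrite ger0_norm ?cnorm_ge0.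
have lc : cnorm l <= c.
  apply/ler_addgt0Pr => e e0; have [n [H _]] := near_l e e0.
  by have := cnormD (u n) (l - u n); rewrite subrKC cnormB; have := uball n; lra.
have fl : f l = l.
  apply/eqP; rewrite -subr_eq0; apply/eqP/cnorm_small => e e0.
  have [n [H1 H2]] := near_l (e / 2) (divr_gt0 e0 (ltr0Sn _ 1)).
  have := cnormD (f l - f (u n)) (f (u n) - l).
  rewrite addrA subrK; have := flip l (u n) lc (uball n).
  move: H2; rewrite (cnormB l) /u iterS -/(u n).
  by have := cnorm_ge0 (u n - l); nra.
have ls : star l = l.
  apply/eqP; rewrite -subr_eq0; apply/eqP/cnorm_small => e e0.
  have [n [H _]] := near_l (e / 2) (divr_gt0 e0 (ltr0Sn _ 1)).
  have := cnormD (star l - u n) (u n - l); rewrite addrA subrK.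
  have -> : cnorm (star l - u n) = cnorm (u n - l).
    by rewrite -{1}(ustar n) -starB cnorm_starE cnormB.
  lra.
exists (1 - l); split; first by rewrite starB star1 ls.
have : a + l * l = l *+ 2.
  by rewrite -[in RHS]fl /f -scaleC_nat scaleC mulfV ?pnatr_eq0// scale1C.
move=> /(canRL (addrK _)) ->.
by rewrite mulrBr mulr1 mulrBl mul1r mulr2n -addrA -opprD [l + (l - _)]addrA.
Qed.

Lemma state_contraction (omega : {scalar A}) a : is_state omega ->
  star a = a -> cnorm a <= 1 -> re_state omega (a * a) <= 1.
Proof.
move=> so aa a1; set t := re_state omega (a * a).
have aa1 : cnorm (a * a) <= 1.
  by have := cnormM a a; have := cnorm_ge0 a; nra.
have small r : 0 <= r -> r < 1 -> r * t <= 1.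
  move=> r0 r1.
  have [||s [ss sE]] := @sqrt_one_minus ((r%:C)%C *: (a * a)).
  - by rewrite starZr starM aa.
  - by rewrite cnormZr ger0_norm//; have := cnorm_ge0 (a * a); nra.
  have := re_state_sos so (sos_sqr ss).
  by rewrite sE re_stateB re_state1// re_stateZ -/t subr_ge0.
rewrite leNgt; apply/negP => t1.
have t0 : 0 < t by lra.
(* For t > 1 the number r = 2 / (1 + t) is below 1, while r t = 2 t / (1 + t) exceeds 1. *)
have := small (2 / (1 + t)); rewrite ltr_pdivrMr ?divr_ge0; try lra.
move=> /(_ isT); rewrite mul1r => H.
have : 2 / (1 + t) * t <= 1 by apply: H; lra.
by rewrite mulrAC ler_pdivrMr; lra.
Qed.

Lemma Tsirelson_bound (omega : {scalar A}) a1 a2 b1 b2 : is_state omega ->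
  (forall x, x \in [:: a1; a2; b1; b2] -> star x = x /\ cnorm x <= 1) ->
  re_state omega (((2^-1)%:C)%C *: (a1 * (b1 + b2) + a2 * (b1 - b2))) <=
    Num.sqrt 2.
Proof.
move=> so H.
have sq x : x \in [:: a1; a2; b1; b2] -> re_state omega (x * x) <= 1.
  by move=> /H [xx x1]; exact: state_contraction.
have [a1s _] := H a1 (mem_head _ _).
have [a2s _] := H a2 ltac:(by rewrite !inE eqxx orbT).
have [b1s _] := H b1 ltac:(by rewrite !inE eqxx !orbT).
have [b2s _] := H b2 ltac:(by rewrite !inE eqxx !orbT).
have := sq a1 (mem_head _ _).
have := sq a2 ltac:(by rewrite !inE eqxx orbT).
have := sq b1 ltac:(by rewrite !inE eqxx !orbT).
have := sq b2 ltac:(by rewrite !inE eqxx !orbT).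
have s2 : Num.sqrt 2 ^+ 2 = 2 :> R by rewrite sqr_sqrtr.
have s0 : 0 < Num.sqrt 2 :> R by rewrite sqrtr_gt0.
set s := Num.sqrt 2 in s2 s0 *.
(* In the sum of the two squares the mixed terms in [b1] and [b2] cancel. With R the Bell operator,
   4 s rho(R) is at most twice the sum of the four expectations of squares, so at most 8, and 2 / s
   = s. *)
have := re_state_sos so (sos_square ((s%:C)%C *: a1 - (b1 + b2))).
have := re_state_sos so (sos_square ((s%:C)%C *: a2 - (b1 - b2))).
rewrite !(starB, starD, starZr) a1s a2s b1s b2s.
have sym x y : star x = x -> star y = y ->
    re_state omega (x * y) = re_state omega (y * x).
  by move=> xx yy; rewrite -re_state_star// starM xx yy.
rewrite !(mulrDl, mulrDr, mulrBl, mulrBr) !(mulNr, mulrN) -!(scalerAl, scalerAr).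
rewrite !(mulrDl, mulrDr, mulNr, mulrN) !(re_stateD, re_stateN, re_stateZ).
rewrite (sym b1 a1)// (sym b1 a2)// (sym b2 a1)// (sym b2 a2)// (sym b2 b1)//.
set x11 := re_state _ (a1 * b1); set x12 := re_state _ (a1 * b2).
set x21 := re_state _ (a2 * b1); set x22 := re_state _ (a2 * b2).
move=> H1 H2 B2 B1 A2 A1.
nra.
Qed.

End SquareRoot.

(** * Hilbert space tensor products and the algebra of the spatial tensor product *)

Section Tensor.
Context {R : realType}.

Section Inner.
Context {H : hilbertType R}.
Implicit Types (x y z v : H) (k : R[i]%C).

Lemma innerDr x y z : inner x (y + z) = inner x y + inner x z.
Proof. by rewrite (innerC (y + z)) (innerC y) (innerC z) innerDl rmorphD. Qed.

Lemma innerZr k x y : inner x (k *: y) = k^* * inner x y.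
Proof. by rewrite (innerC (k *: y)) (innerC y) innerZl rmorphM. Qed.

Lemma inner0l y : inner 0 y = 0.
Proof. by rewrite -(scale0r (0 : H)) innerZl mul0r. Qed.

Lemma innerNr x y : inner x (- y) = - inner x y.
Proof. by rewrite -scaleN1r innerZr rmorphN rmorph1 mulN1r. Qed.

Lemma innerBr x y z : inner x (y - z) = inner x y - inner x z.
Proof. by rewrite innerDr innerNr. Qed.

(** A point z of S closer to v than |v| would contradict Pythagoras, which gives |v - z|^2 = |v|^2 +
    |z|^2. *)
Lemma closure_orthogonal (S : set H) v : closure S = setT ->
  (forall z, S z -> inner z v = 0) -> v = 0.
Proof.
move=> dense orth; apply: contrapT => /eqP; rewrite -normr_gt0 => v0.
have : closure S v by rewrite dense.
move=> /(_ _ (nbhsx_ballx v _ v0)) [z [Sz]].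
rewrite -ball_normE /ball_ /= => lt_v.
have : `|v - z| ^+ 2 = `|v| ^+ 2 + `|z| ^+ 2.
  have zv := orth z Sz; have vz : inner v z = 0 by rewrite innerC zv rmorph0.
  rewrite -!inner_norm innerBr !innerDl -!(scaleN1r z) !innerZl zv vz.
  by rewrite mulr0 addr0 add0r mulN1r opprK.
have : `|v - z| ^+ 2 < `|v| ^+ 2 by rewrite ltr_pXn2r ?nnegrE.
by move=> + E; rewrite E gtrDl le_gtF// exprn_ge0.
Qed.

End Inner.

Lemma hilbert_tensor_orthogonal (H1 H2 K : hilbertType R)
    (t : {bilinear H1 -> H2 -> K}) (v : K) : hilbert_tensor t ->
  (forall x y, inner (t x y) v = 0) -> v = 0.
Proof.
move=> [_ dense] orth; apply: (closure_orthogonal dense) => z [n [x [y ->]]].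
elim/big_ind : _ => [|a b|i _]; [exact: inner0l| |exact: orth].
by move=> a0 b0; rewrite innerDl a0 b0 addr0.
Qed.

Section Representation.
Context {A : cstarAlgType R} {H : hilbertType R} (pi : A -> {linear H -> H}).
Hypothesis rep_pi : star_rep pi.
Implicit Types (a b : A) (v w : H).

Lemma rep_starr a v w : inner v (pi a w) = inner (pi (star a) v) w.
Proof. by rewrite (rep_star rep_pi) starK. Qed.

Lemma rep0 v : pi 0 v = 0.
Proof.
have := rep_linear rep_pi (-1) 0 0 v.
by rewrite scaler0 addr0 scaleN1r addNr.
Qed.

Lemma repD a b v : pi (a + b) v = pi a v + pi b v.
Proof. by have := rep_linear rep_pi 1 a b v; rewrite !scale1r. Qed.

Lemma repB a b v : pi (a - b) v = pi a v - pi b v.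
Proof.
by have := rep_linear rep_pi (-1) b a v; rewrite !scaleN1r addrC => ->; rewrite addrC.
Qed.

Lemma rep_sos a v : sos a -> 0 <= inner (pi a v) v.
Proof.
move=> [ys ->]; elim: ys => [|y ys IH]; first by rewrite big_nil rep0 inner0l.
rewrite big_cons repD innerDl addr_ge0// (repM rep_pi) (rep_star rep_pi) starK.
by rewrite inner_norm exprn_ge0.
Qed.

Lemma rep_contraction a v : sos (1 - star a * a) -> `|pi a v| <= `|v|.
Proof.
move=> /(rep_sos v); rewrite repB (rep1 rep_pi) (repM rep_pi).
rewrite innerDl -scaleN1r innerZl (rep_star rep_pi) starK !inner_norm mulN1r subr_ge0.
by rewrite ler_pXn2r ?nnegrE.
Qed.

Hypothesis cnorm_pi : forall x : A, cnorm x = opnorm (pi x).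

Lemma cnorm_le_rep a (c : R) : 0 <= c -> (forall v, `|pi a v| <= (c%:C)%C * `|v|) ->
  cnorm a <= c.
Proof.
move=> c0 ac; rewrite cnorm_pi /opnorm; apply: ge_inf; last by split.
by exists 0 => r [].
Qed.

(** This turns algebraic positivity into a norm bound: a sum of squares acts as a positive operator,
    and the norm is the operator norm of the representation. *)
Lemma cnorm_le1 a : sos (1 - star a * a) -> cnorm a <= 1.
Proof.
move=> a1; apply: cnorm_le_rep => // v.
by rewrite rmorph1 mul1r; exact: rep_contraction.
Qed.

Lemma isometric_rep_faithful : faithful pi.
Proof.
move=> a a0; apply: (@cnorm_eq0 R A a); apply/eqP; rewrite eq_le cnorm_ge0 andbT.
by apply: cnorm_le_rep => // v; rewrite a0 normr0 rmorph0 mul0r.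
Qed.

End Representation.

Section Spatial.
Context {A B T : cstarAlgType R} (tens : A -> B -> T).
Hypothesis hT : spatial_tensor tens.
Implicit Types (X Y : T) (k : R[i]%C).

Lemma spatial_cnorm_le1 X : sos (1 - star X * X) -> cnorm X <= 1.
Proof.
have [_ [H1 [H2 [K [t [pi1 [pi2 [pi [_ _ _ [rep_pi cnorm_pi] _]]]]]]]]] := hT.
move=> x1; exact: (cnorm_le1 rep_pi cnorm_pi x1).
Qed.

(** Elements of [T] are determined by their action on simple tensors, whose span is dense, and on
    these each identity holds factor by factor. *)
Lemma spatial_tensor_morphism :
  [/\ tens 1 1 = 1,
      forall a b a' b', tens a b * tens a' b' = tens (a * a') (b * b'),
      forall a b, star (tens a b) = tens (star a) (star b),
      forall k a a' b, tens (k *: a + a') b = k *: tens a b + tens a' b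
    & forall k a b b', tens a (k *: b + b') = k *: tens a b + tens a b'].
Proof.
have [_ [H1 [H2 [K [t [pi1 [pi2 [pi [ht]]]]]]]]] := hT.
move=> [rep_pi1 _] [rep_pi2 _] [rep_pi cnorm_pi] tensE.
have uniq X Y : (forall x y, pi X (t x y) = pi Y (t x y)) -> X = Y.
  move=> XY; have faithful_pi := isometric_rep_faithful cnorm_pi.
  (* Passing to the adjoint moves X - Y onto the simple tensor inside the inner product, where it
     vanishes; density then does the rest. *)
  have XY0 : star (X - Y) = 0.
    apply: (faithful_pi) => v; apply: (hilbert_tensor_orthogonal ht) => x y.
    by rewrite (rep_starr rep_pi) starK (repB rep_pi) XY subrr inner0l.
  by apply/eqP; rewrite -subr_eq0 -[X - Y]starK XY0 star0.
split.
- by apply: uniq => x y; rewrite tensE (rep1 rep_pi) (rep1 rep_pi1) (rep1 rep_pi2).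
- move=> a b a' b'; apply: uniq => x y.
  by rewrite (repM rep_pi) !tensE !(repM rep_pi1, repM rep_pi2).
- move=> a b; apply: uniq => x y; apply/eqP; rewrite -subr_eq0; apply/eqP.
  apply: (hilbert_tensor_orthogonal ht) => x' y'.
  rewrite innerBr (rep_starr rep_pi) starK !tensE !ht.1.
  by rewrite (rep_starr rep_pi1) (rep_starr rep_pi2) !starK subrr.
- move=> k a a' b; apply: uniq => x y.
  by rewrite (rep_linear rep_pi) !tensE (rep_linear rep_pi1) linearPl.
- move=> k a b b'; apply: uniq => x y.
  by rewrite (rep_linear rep_pi) !tensE (rep_linear rep_pi2) linearPr.
Qed.

End Spatial.
End Tensor.

(** * Mirror images in the commuting algebra, and the Bell operators built from them *)

Section Mirror.
Context {R : realType} {T : cstarAlgType R} (omega : {scalar T}).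
Hypothesis state_omega : is_state omega.
Implicit Types (x y z h g u v : T) (S : set T).
Local Notation rho := (re_state omega).
Local Notation null := (null omega).

(** Null elements form only a left ideal, so y' has to be moved to the left of x - x'; this is what
    the commutations are for. *)
Lemma null_mulB x x' y y' : y' * x = x * y' -> y' * x' = x' * y' ->
  null (x - x') -> null (y - y') -> null (x * y - x' * y').
Proof.
move=> yx yx' nx ny.
have -> : x * y - x' * y' = x * (y - y') + y' * (x - x').
  by rewrite !mulrBr yx yx' addrA subrK.
by apply: nullD; exact: nullM.
Qed.

Lemma null_newton h h' : h * h' = h' * h -> null (h - h') ->
  null (newton h - newton h').
Proof.
move=> hh' n; rewrite /newton -scalerBr; apply: nullZ.
have comm3 y : h' * y = y * h' -> (3 - h' * h') * y = y * (3 - h' * h').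
  by move=> hy; rewrite mulrBl mulrBr mulr_natl mulr_natr -mulrA !hy !mulrA hy.
apply: null_mulB => //; try exact: comm3.
rewrite opprB addrC subrKA -opprB; apply: nullN.
exact: null_mulB.
Qed.

Definition star_subalgebra S :=
  [/\ S 1, forall (k : R[i]%C) x y, S x -> S y -> S (k *: x + y),
      forall x y, S x -> S y -> S (x * y) & forall x, S x -> S (star x)].

Section Subalgebra.
Variable S : set T.
Hypothesis subS : star_subalgebra S.

Lemma subalgD x y : S x -> S y -> S (x + y).
Proof. by case: subS => _ lin _ _ Sx Sy; rewrite -(scale1r x); exact: lin. Qed.

Lemma subalg0 : S 0.
Proof. by case: subS => S1 lin _ _; rewrite -(addNr 1) -scaleN1r; exact: lin. Qed.

Lemma subalgZ (k : R[i]%C) x : S x -> S (k *: x).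
Proof.
case: (subS) => _ lin _ _ Sx; rewrite -[_ *: _]addr0.
by apply: lin => //; exact: subalg0.
Qed.

Lemma subalgB x y : S x -> S y -> S (x - y).
Proof. by move=> Sx Sy; rewrite -scaleN1r; apply: subalgD => //; exact: subalgZ. Qed.

Lemma subalg_nat n : S n%:R.
Proof.
elim: n => [|n IH]; first exact: subalg0.
by rewrite mulrS; apply: subalgD => //; case: subS.
Qed.

Lemma subalg_re_part u : S u -> S (re_part u).
Proof.
by move=> Su; apply/subalgZ/subalgD => //; case: subS => _ _ _; apply.
Qed.

Lemma subalg_iter_newton h n : S h -> S (iter n newton h).
Proof.
case: (subS) => _ _ mul _ Sh; elim: n => //= n Sn.
apply/subalgZ/mul => //; apply: subalgB; first exact: subalg_nat.
exact: mul.
Qed.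

End Subalgebra.

Variables S1 S2 : set T.
Hypotheses (subS1 : star_subalgebra S1) (subS2 : star_subalgebra S2).
Hypothesis commS : forall x y, S1 x -> S2 y -> x * y = y * x.

Lemma null_iter_newton h h' n : S1 h -> S2 h' -> null (h - h') ->
  null (iter n newton h - iter n newton h').
Proof.
move=> Sh Sh' nh; elim: n => [//|n IH] /=; apply: null_newton => //.
by apply: commS; exact: subalg_iter_newton.
Qed.

(** On the state vector h' may be replaced by h, so the correlation of h with h' is rho (h^2), which
    is 1 minus the defect. *)
Lemma mirrored_correlation u u' e : S1 u -> S2 u' -> unitary u ->
    null (u - u') -> null (star u - star u') ->
    (forall n, omega (u ^+ n.+1) = 0) -> 0 < e ->
  exists k, 1 - e <=
    rho (iter k newton (re_part u) * iter k newton (re_part u')).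
Proof.
move=> Su Su' hu nu nu' u0 e0.
have [k small] := newton_defect_small state_omega hu u0 e0.
exists k; move: small => /=.
set h := iter k newton (re_part u); set h' := iter k newton (re_part u').
rewrite re_stateB re_state1// => small.
have nh : null (h - h').
  apply: null_iter_newton; try exact: subalg_re_part.
  rewrite /re_part -scalerBr opprD addrACA.
  by apply: nullZ; exact: nullD.
have := nh h; rewrite mulrBr linearB /= => /eqP; rewrite subr_eq0 => /eqP E.
by rewrite /re_state -E; move: small; rewrite /re_state; lra.
Qed.

Hypothesis cnorm_le1_sos : forall x, sos (1 - star x * x) -> cnorm x <= 1.

Lemma bell_violation u v u' v' e :
    [/\ S1 u, S1 v, S2 u' & S2 v'] ->
    [/\ unitary u, unitary v, unitary u' & unitary v'] ->
    anticommute u' v' ->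
    [/\ null (u - u'), null (star u - star u'), null (v - v')
      & null (star v - star v')] ->
    (forall n, omega (u ^+ n.+1) = 0) -> (forall n, omega (v ^+ n.+1) = 0) ->
    0 < e ->
  exists2 x, bell_operators S1 S2 x & Num.sqrt 2 - e <= rho x.
Proof.
move=> [Su Sv Su' Sv'] [hu hv hu' hv'] uv' [nu nsu nv nsv] u0 v0 e0.
have e2 : 0 < e / 2 by rewrite divr_gt0.
have [k Hk] := mirrored_correlation Su Su' hu nu nsu u0 e2.
have [l Hl] := mirrored_correlation Sv Sv' hv nv nsv v0 e2.
have anti := anticommute_iter_newton k l (anticommute_re_part hu' hv' uv').
have [h1 h2 _] := iter_newton k (star_re_part u) (sos_re_part hu).
have [g1 g2 _] := iter_newton l (star_re_part v) (sos_re_part hv).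
have [h1' h2' _] := iter_newton k (star_re_part u') (sos_re_part hu').
have [g1' g2' _] := iter_newton l (star_re_part v') (sos_re_part hv').
have Sh : S1 (iter k newton (re_part u)).
  by apply: subalg_iter_newton => //; exact: subalg_re_part.
have Sg : S1 (iter l newton (re_part v)).
  by apply: subalg_iter_newton => //; exact: subalg_re_part.
have Sh' : S2 (iter k newton (re_part u')).
  by apply: subalg_iter_newton => //; exact: subalg_re_part.
have Sg' : S2 (iter l newton (re_part v')).
  by apply: subalg_iter_newton => //; exact: subalg_re_part.
move: Hk Hl anti h1 h2 g1 g2 h1' h2' g1' g2' Sh Sg Sh' Sg'.
move: (iter k newton (re_part u)) (iter l newton (re_part v)) => h g.
move: (iter k newton (re_part u')) (iter l newton (re_part v')) => h' g'.
move=> Hk Hl anti h1 h2 g1 g2 h1' h2' g1' g2' Sh Sg Sh' Sg'.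
have s2 : Num.sqrt 2 ^+ 2 = 2 :> R by rewrite sqr_sqrtr.
have s0 : 0 < Num.sqrt 2 :> R by rewrite sqrtr_gt0.
set s := Num.sqrt 2 in s2 s0 *.
(* Anticommutation of h' and g' cancels the mixed terms, so both squares equal (h'^2 + g'^2) / 2 <=
   1. *)
pose b1 := ((s^-1)%:C)%C *: (h' + g'); pose b2 := ((s^-1)%:C)%C *: (h' - g').
have ss : s^-1 * s^-1 = 2^-1 by rewrite -invfM -expr2 s2.
have half x : ((2^-1)%:C)%C *: (x *+ 2) = x.
  by rewrite -scaleC_nat scaleC mulVf ?pnatr_eq0// scale1C.
have half_sos : sos (((2^-1)%:C)%C *: ((1 - h' * h') + (1 - g' * g'))).
  by apply: sosZ; [rewrite invr_ge0|exact: sosD].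
have contr1 : sa_contraction S2 b1.
  have sb : star b1 = b1 by rewrite /b1 starZr starD h1' g1'.
  split=> //; first by apply: (subalgZ subS2); exact: (subalgD subS2).
  apply: cnorm_le1_sos; rewrite sb.
  have -> // : 1 - b1 * b1 = ((2^-1)%:C)%C *: ((1 - h' * h') + (1 - g' * g')).
  rewrite /b1 -scalerAl -scalerAr scaleC ss -[X in X - _]half -scalerBr.
  have -> : (h' + g') * (h' + g') = h' * h' + g' * g'.
    by rewrite mulrDl !mulrDr anti addrA subrK.
  by rewrite mulr2n opprD addrACA.
have contr2 : sa_contraction S2 b2.
  have sb : star b2 = b2 by rewrite /b2 starZr starB h1' g1'.
  split=> //; first by apply: (subalgZ subS2); exact: (subalgB subS2).
  apply: cnorm_le1_sos; rewrite sb.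
  have -> // : 1 - b2 * b2 = ((2^-1)%:C)%C *: ((1 - h' * h') + (1 - g' * g')).
  rewrite /b2 -scalerAl -scalerAr scaleC ss -[X in X - _]half -scalerBr.
  have -> : (h' - g') * (h' - g') = h' * h' + g' * g'.
    by rewrite mulrBl !mulrBr anti opprK opprD opprK addrA addrK.
  by rewrite mulr2n opprD addrACA.
exists ((2^-1 : R[i]%C) *: (h * (b1 + b2) + g * (b1 - b2))).
  exists h, g, b1, b2; split=> //; split; split=> //; apply: cnorm_le1_sos.
    by rewrite h1.
  by rewrite g1.
have sD : b1 + b2 = (s%:C)%C *: h'.
  rewrite /b1 /b2 -scalerDr addrACA subrr addr0 -mulr2n -scaleC_nat scaleC.
  by congr ((_%:C)%C *: _); rewrite -s2 expr2 mulKf// gt_eqF.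
have sB : b1 - b2 = (s%:C)%C *: g'.
  rewrite /b1 /b2 -scalerBr opprB [g' - h']addrC addrACA subrr add0r.
  rewrite -mulr2n -scaleC_nat scaleC.
  by congr ((_%:C)%C *: _); rewrite -s2 expr2 mulKf// gt_eqF.
have -> : (2^-1 : R[i]%C) = ((2^-1)%:C)%C by rewrite fmorphV rmorph_nat.
rewrite sD sB -!scalerAr -scalerDr scaleC re_stateZ re_stateD.
(* The Bell operator has become (s / 2) (h h' + g g'), with expectation at least (s / 2) (2 - e) = s
   - s e / 2; as s <= 2, this is at least s - e. *)
have sle : s <= 2 by nra.
move: Hk Hl; set a := rho _; set b := rho _ => Hk Hl.
nra.
Qed.

(** The state vector is an eigenvector of z with eigenvalue of modulus one, so conjugating y by z
    preserves its expectation; anticommutation makes the same conjugation change its sign. *)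
Lemma state_anticommute z y (d : R[i]%C) : unitary z -> omega z = d ->
  d^* * d = 1 -> anticommute z y -> omega y = 0.
Proof.
move=> hz zd dd zy; have nz := null_eigen state_omega hz zd dd.
have E x : omega (x * z) = d * omega x.
  have := nz x; rewrite mulrBr linearB /= -scalerAr stateZ mulr1 => /eqP.
  by rewrite subr_eq0 => /eqP.
have : omega (star z * y * z) = omega y.
  have -> : star z * y = star (star y * z) by rewrite starM starK.
  rewrite E state_star// E state_star//.
  by rewrite rmorphM mulrA (mulrC d) dd mul1r; exact: conjcK.
rewrite -mulrA -[y * z]opprK -zy mulrN mulrA hz.1 mul1r linearN /=.
by move/eqP; rewrite eq_sym -subr_eq0 opprK -mulr2n mulrn_eq0 => /eqP.
Qed.

End Mirror.

(** * Weyl operators in the EPR state *)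

Section EPR.
Context {R : realType}.

Lemma expi_conjM (r : R) : (expi r)^* * expi r = 1.
Proof.
rewrite /expi; apply/eqP; rewrite eq_complex; apply/andP; split; apply/eqP => /=.
  by rewrite mulNr opprK -!expr2 cos2Dsin2.
by ring.
Qed.

Lemma expi0 : expi (0 : R) = 1.
Proof. by rewrite /expi cos0 sin0. Qed.

Section Weyl.
Context {A : cstarAlgType R} (W : R * R -> A).
Hypothesis hW : weyl_algebra W.

Lemma weyl_unitary z : unitary (W z). Proof. by case: hW. Qed.

Lemma weylM z w : W z * W w = expi (sigma z w) *: W (z + w).
Proof. by case: hW. Qed.

Lemma weyl0 : W 0 = 1.
Proof.
have := weylM 0 0; rewrite /sigma mul0r subrr mulr0 expi0 scale1r addr0.
move/(congr1 (fun x => star (W 0) * x)).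
by rewrite mulrA (weyl_unitary 0).1 mul1r.
Qed.

Lemma weylX z n : W z ^+ n = W (z.1 *+ n, z.2 *+ n).
Proof.
elim: n => [|n IH]; first by rewrite expr0 -weyl0.
rewrite exprS IH weylM /sigma /= mulrnAr mulrnAr mulrC (mulrC z.2) subrr mul0r.
by rewrite expi0 scale1r !mulrS; case: z {IH}.
Qed.

(** The two orders of the product carry the phases i and -i. *)
Lemma weyl_anticommute z w : sigma z w = pi / 2 -> anticommute (W z) (W w).
Proof.
move=> zw; rewrite /anticommute !weylM zw.
have -> : sigma w z = - (pi / 2).
  by rewrite -zw /sigma; ring.
rewrite (addrC w) -scaleNr; congr (_ *: _).
rewrite /expi cosN sinN cos_pihalf sin_pihalf.
by apply/eqP; rewrite eq_complex /= oppr0 opprK !eqxx.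
Qed.

Context {T : cstarAlgType R} (tens : A -> A -> T).
Hypothesis hT : spatial_tensor tens.
Variable omega : {scalar T}.
Hypothesis state_omega : is_state omega.

(** Perfect correlation of two Weyl operators. The parameters of the EPR state enter only through
    the phase [c]. *)
Definition correlated z w :=
  exists2 c : R[i]%C, c^* * c = 1 & omega (tens (W z) (W w)) = c.

Lemma unitary_tens a b : unitary a -> unitary b -> unitary (tens a b).
Proof.
have [t1 tM tS _ _] := spatial_tensor_morphism hT.
by move=> [a1 a2] [b1 b2]; rewrite /unitary tS !tM a1 a2 b1 b2 t1.
Qed.

Lemma tensNl a b : tens (- a) b = - tens a b.
Proof.
have [_ _ _ tl _] := spatial_tensor_morphism hT.
have t0 : tens 0 b = 0.
  have := tl 1 0 0 b; rewrite !scale1r addr0 => H.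
  by apply: (addrI (tens 0 b)); rewrite -H addr0.
by have := tl (-1) a 0 b; rewrite !scaleN1r t0 !addr0.
Qed.

Lemma tensNr a b : tens a (- b) = - tens a b.
Proof.
have [_ _ _ _ tr] := spatial_tensor_morphism hT.
have t0 : tens a 0 = 0.
  have := tr 1 a 0 0; rewrite !scale1r addr0 => H.
  by apply: (addrI (tens a 0)); rewrite -H addr0.
by have := tr (-1) a b 0; rewrite !scaleN1r t0 !addr0.
Qed.

Lemma range_tensl : star_subalgebra (range (fun a => tens a 1)).
Proof.
have [t1 tM tS tl _] := spatial_tensor_morphism hT; split.
- by exists 1.
- by move=> k _ _ [a _ <-] [b _ <-]; exists (k *: a + b).
- by move=> _ _ [a _ <-] [b _ <-]; exists (a * b) => //; rewrite tM mulr1.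
- by move=> _ [a _ <-]; exists (star a) => //; rewrite tS star1.
Qed.

Lemma range_tensr : star_subalgebra (range (fun b => tens 1 b)).
Proof.
have [t1 tM tS _ tr] := spatial_tensor_morphism hT; split.
- by exists 1.
- by move=> k _ _ [a _ <-] [b _ <-]; exists (k *: a + b).
- by move=> _ _ [a _ <-] [b _ <-]; exists (a * b) => //; rewrite tM mulr1.
- by move=> _ [a _ <-]; exists (star a) => //; rewrite tS star1.
Qed.

(** The n-th power is again a Weyl operator, and it anticommutes with the perfectly correlated pair,
    to which [state_anticommute] applies. *)
Lemma state_weyl_power z y y' n : correlated y y' ->
    sigma y (z.1 *+ n, z.2 *+ n) = pi / 2 ->
  omega (tens (W z) 1 ^+ n) = 0.
Proof.
have [t1 tM tS tl _] := spatial_tensor_morphism hT.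
move=> [c cc yc] yz.
have -> : tens (W z) 1 ^+ n = tens (W (z.1 *+ n, z.2 *+ n)) 1.
  rewrite -weylX; elim: n {yz} => [|n IH]; first by rewrite !expr0 t1.
  by rewrite !exprS IH tM mulr1.
apply: (state_anticommute state_omega _ yc cc).
  by apply: unitary_tens; exact: weyl_unitary.
by rewrite /anticommute !tM mulr1 mul1r weyl_anticommute// tensNl.
Qed.

(** The eigenvalue equation of W(z) (x) W(w) is multiplied from the left by the adjoint of one
    factor: that of W(w) gives the first claim, that of W(z), after scaling by the conjugate phase,
    the second. *)
Lemma correlated_mirror z w c : c^* * c = 1 -> omega (tens (W z) (W w)) = c ->
  let u := tens (W z) 1 in let u' := c *: tens 1 (star (W w)) in
  null omega (u - u') /\ null omega (star u - star u').
Proof.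
have [t1 tM tS _ _] := spatial_tensor_morphism hT.
move=> cc zc u u'.
have hZ : unitary (tens (W z) (W w)) by apply: unitary_tens; exact: weyl_unitary.
have nZ := null_eigen state_omega hZ zc cc.
have [z1 z2] := weyl_unitary z; have [w1 w2] := weyl_unitary w.
split.
  have := nullM (tens 1 (star (W w))) nZ.
  by rewrite mulrBr tM mul1r w1 -scalerAr mulr1.
have := nullZ (- c^*) (nullM (tens (star (W z)) 1) nZ).
rewrite mulrBr tM mul1r z1 -scalerAr mulr1 scalerBr scalerA mulNr cc.
rewrite scaleN1r opprK addrC scaleNr.
by rewrite /u /u' starZ !tS star1 starK.
Qed.

End Weyl.
End EPR.

Theorem theorem2 (R : realType) (lam mu : R)
    (A : cstarAlgType R) (W : R * R -> A) (hW : weyl_algebra W)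
    (T : cstarAlgType R) (tens : A -> A -> T) (hT : spatial_tensor tens)
    (omega : {scalar T}) (homega : EPR_state W tens lam mu omega) :
  maximally_bell_correlated omega
    (range (fun a : A => tens a 1)) (range (fun b : A => tens 1 b)).
Proof.
have [state_omega corrQ corrP] := homega.
have cQ a : correlated W tens omega (a, 0) (- a, 0).
  by exists (expi (a * lam)); [exact: expi_conjM|].
have cP b : correlated W tens omega (0, b) (0, b).
  by exists (expi (b * mu)); [exact: expi_conjM|].
have [t1 tM tS tl tr] := spatial_tensor_morphism hT.
set S1 := range (fun a => tens a 1); set S2 := range (fun b => tens 1 b).
have comm x y : S1 x -> S2 y -> x * y = y * x.
  by move=> [a _ <-] [b _ <-]; rewrite !tM !mulr1 !mul1r.
have upper x : bell_operators S1 S2 x -> re_state omega x <= Num.sqrt 2.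
  move=> [a1 [a2 [b1 [b2 [[[_ ? ?] [_ ? ?]] [[_ ? ?] [_ ? ?]] ->]]]]].
  have -> : (2^-1 : R[i]%C) = ((2^-1)%:C)%C by rewrite fmorphV rmorph_nat.
  apply: Tsirelson_bound => // y.
  by rewrite !inE => /or4P[] /eqP ->.
have lower e : 0 < e ->
    exists2 x, bell_operators S1 S2 x & Num.sqrt 2 - e <= re_state omega x.
  (* The parameters 1 and pi give the pairing sigma the value pi / 2, so the two Weyl operators
     anticommute. *)
  have [c cc zc] := cQ 1; have [d dd wd] := cP pi.
  have [nu nsu] := correlated_mirror hW hT state_omega cc zc.
  have [nv nsv] := correlated_mirror hW hT state_omega dd wd.
  have uW := weyl_unitary hW.
  have un1 : unitary (1 : A) by rewrite /unitary star1 mulr1.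
  apply: (bell_violation state_omega (range_tensl hT) (range_tensr hT) comm
    (@spatial_cnorm_le1 _ _ _ _ _ hT) _ _ _ (And4 nu nsu nv nsv)).
  - split; [by exists (W (1, 0))|by exists (W (0, pi))| |];
      by apply: (subalgZ (range_tensr hT)); eexists.
  - split; try exact: (unitary_tens hT).
      by apply: unitaryZ => //; apply: (unitary_tens hT) => //; exact: unitary_star.
    by apply: unitaryZ => //; apply: (unitary_tens hT) => //; exact: unitary_star.
  - apply: anticommuteZ; rewrite /anticommute !tM mulr1.
    have anti : anticommute (star (W (-1, 0))) (star (W (0, pi))).
      (* The adjoints are removed one at a time, which leaves the pair in the order where sigma is +
         pi / 2. *)
      apply: anticommute_starl => //; apply: anticommuteC.
      apply: anticommute_starl => //; apply: (weyl_anticommute hW).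
      by rewrite /sigma /=; lra.
    by rewrite anti (tensNr hT).
  (* The correlated pair is scaled by 1 / (n + 1) to compensate for the power, so that sigma is
     exactly pi / 2; the same happens for v below. *)
  - move=> n; apply: (state_weyl_power hW hT state_omega (cP (- pi / n.+1%:R))).
    by rewrite /sigma /=; field; rewrite ?(natr1, nat1r) pnatr_eq0.
  - move=> n; apply: (state_weyl_power hW hT state_omega (cQ (n.+1%:R^-1))).
    by rewrite /sigma /= -mulr_natr; field; rewrite ?(natr1, nat1r) pnatr_eq0.
rewrite /maximally_bell_correlated /bell_correlation.
set E := [set _ | _ in _].
have ubE : ubound E (Num.sqrt 2) by move=> _ [x Bx <-]; exact: upper.
(* Any positive tolerance would do: a member of the set is wanted, so that its [sup] is a genuine
   supremum. *)
have [x0 Bx0 _] := lower 1 ltr01.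
apply/eqP; rewrite eq_le; apply/andP; split.
  by apply: ge_sup => //; exists (re_state omega x0); exists x0.
apply/ler_addgt0Pr => e e0; have [x Bx xe] := lower e e0.
rewrite -lerBlDr (le_trans xe)//; apply: ub_le_sup; last by exists x.
by exists (Num.sqrt 2).
Qed.
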